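(* Let $G$ be a finite simple connected graph with $m\ge 1$ edges and maximum degree $\Delta$. Then $$GA_1(G)+\Delta R(G)\ge 2m,$$ and the equality holds if and only if $G$ is a regular graph.
   Context: For a graph $G$ with vertex set $V(G)$ and edge set $E(G)$, $d_u$ denotes the degree of the vertex $u$. The first geometric-arithmetic index is $GA_1(G)=\sum_{uv\in E(G)}\frac{2\sqrt{d_ud_v}}{d_u+d_v}$. The Randić index is $R(G)=\sum_{uv\in E(G)}\frac{1}{\sqrt{d_ud_v}}$. *)

(* Defs.v *)
From HB Require Import structures.
From mathcomp Require Import all_boot all_order all_algebra.
From mathcomp Require Import reals.

Set Implicit Arguments.
Unset Strict Implicit.
Unset Printing Implicit Defensive.

Import Order.TTheory GRing.Theory Num.Theory.
Local Open Scope ring_scope.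

Record sgraph := SGraph {
  vertex :> finType;
  adj : rel vertex;
  adj_sym : symmetric adj;
  adj_irrefl : irreflexive adj }.

Definition edges (G : sgraph) : {set {set G}} :=
  [set [set p.1; p.2] | p : G * G & adj p.1 p.2].

Definition deg (G : sgraph) (u : G) : nat := #|[set v : G | adj u v]|.

Definition max_deg (G : sgraph) : nat := \max_(u : G) deg u.

Definition connected_graph (G : sgraph) : Prop :=
  forall u v : G, connect (@adj G) u v.

Definition regular_graph (G : sgraph) : Prop :=
  exists k : nat, forall u : G, deg u = k.

(* Edges are unordered pairs e = {u, v} with u != v, so the product and the
   sum of the degrees over e are d_u d_v and d_u + d_v. *)
Definition geom_arith_index (R : realType) (G : sgraph) : R :=
  \sum_(e in edges G)
    2 * Num.sqrt (\prod_(u in e) (deg u)%:R) / (\sum_(u in e) (deg u)%:R).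

Definition randic_index (R : realType) (G : sgraph) : R :=
  \sum_(e in edges G) 1 / Num.sqrt (\prod_(u in e) (deg u)%:R).

(* Main.v *)
(* Let D be the maximum degree and let uv be an edge with a = d_u, b = d_v and
   s = sqrt (a b).  Since D >= (a + b) / 2, the edge contributes
   2 s / (a + b) + D / s >= x + 1 / x >= 2 with x = 2 s / (a + b), and equality
   forces a = b = D.  In a connected graph with at least one edge every vertex
   lies on an edge, so equality in the sum means that all degrees are D. *)
Require Import Defs.
From mathcomp Require Import all_boot all_order all_algebra.
From mathcomp Require Import reals.
From mathcomp Require Import ring.
Import Order.TTheory GRing.Theory Num.Theory.
Local Open Scope ring_scope.

Lemma ga_randic_term_leif (R : rcfType) (a b D : R) :
    0 < a -> 0 < b -> a <= D -> b <= D ->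
  2 <= 2 * Num.sqrt (a * b) / (a + b) + D * (1 / Num.sqrt (a * b))
    ?= iff (a == D) && (b == D).
Proof.
move=> a_gt0 b_gt0 aD bD; set s := Num.sqrt _.
have ab_gt0 : 0 < a * b by rewrite mulr_gt0.
have s_gt0 : 0 < s by rewrite sqrtr_gt0.
have s2 : a * b = s ^+ 2 by rewrite sqr_sqrtr // ltW.
have t_gt0 : 0 < a + b by rewrite addr_gt0.
(* The numerator splits into two nonnegative parts: a square measuring the AM-GM defect, and the
   distance of [a] and [b] from [D]. The bound and its equality case are both read off it. *)
have diffE : 2 * s / (a + b) + D * (1 / s) - 2 =
    ((2 * s - (a + b)) ^+ 2 + (D - a + (D - b)) * (a + b)) / (2 * s * (a + b)).
  by field; rewrite !gt_eqF.
have den_gt0 : 0 < 2 * s * (a + b) by rewrite !mulr_gt0.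
have sq_ge0 : 0 <= (2 * s - (a + b)) ^+ 2 by rewrite sqr_ge0.
have gap_ge0 : 0 <= (D - a + (D - b)) * (a + b).
  by rewrite mulr_ge0 ?(ltW t_gt0) // addr_ge0 ?subr_ge0.
split; first by rewrite -subr_ge0 diffE divr_ge0 ?addr_ge0 ?(ltW den_gt0).
rewrite eq_sym -subr_eq0 diffE mulf_eq0 invr_eq0 (gt_eqF den_gt0) orbF.
rewrite paddr_eq0 // [X in _ && X]mulf_eq0 (gt_eqF t_gt0) orbF.
rewrite paddr_eq0 ?subr_ge0 // !subr_eq0 ![D == _]eq_sym.
(* The second part alone forces [a = b = D]; conversely, [s = D] then makes the square vanish. *)
case: (eqVneq a D) => [aE|]; last by rewrite /= andbF.
case: (eqVneq b D) => [bE|]; last by rewrite /= andbF.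
have D_gt0 : 0 < D by rewrite -aE.
by rewrite /= andbT /s aE bE -expr2 sqrtr_sqr gtr0_norm //; apply/eqP; ring.
Qed.

Lemma edgesP (G : sgraph) (e : {set G}) :
  reflect (exists u v, adj u v /\ e = [set u; v]) (e \in edges G).
Proof.
apply: (iffP imsetP) => [[[u v] uv ->]|[u [v [uv ->]]]].
  by exists u, v; rewrite inE in uv.
by exists (u, v); rewrite ?inE.
Qed.

Lemma adj_neq (G : sgraph) (u v : G) : adj u v -> u != v.
Proof. by apply: contraTneq => ->; rewrite adj_irrefl. Qed.

Lemma deg_gt0 (G : sgraph) (u v : G) : adj u v -> (0 < deg u)%N.
Proof. by move=> uv; apply/card_gt0P; exists v; rewrite inE. Qed.

Lemma deg_le_max (G : sgraph) (u : G) : (deg u <= max_deg G)%N.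
Proof. exact: leq_bigmax. Qed.

Lemma edge_term_leif (R : realType) (G : sgraph) (e : {set G}) :
    e \in edges G ->
  2 <= 2 * Num.sqrt (\prod_(u in e) (deg u)%:R) / (\sum_(u in e) (deg u)%:R)
       + (max_deg G)%:R * (1 / Num.sqrt (\prod_(u in e) (deg u)%:R))
    ?= iff [forall u in e, deg u == max_deg G] :> R.
Proof.
case/edgesP=> u [v [uv ->]].
(* Irreflexivity gives [u != v], so the product and the sum over [[set u; v]] really have two
   terms. *)
rewrite !big_setU1 ?inE ?adj_neq //= !big_set1.
have vu : adj v u by rewrite adj_sym.
have -> : [forall w in [set u; v], deg w == max_deg G] =
    ((deg u)%:R == (max_deg G)%:R :> R) && ((deg v)%:R == (max_deg G)%:R :> R).
  rewrite !eqr_nat; apply/forall_inP/andP=> [degE|[uD vD] w].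
    by rewrite !degE // !inE eqxx ?orbT.
  by case/set2P=> ->.
by apply: ga_randic_term_leif; rewrite ?ltr0n ?ler_nat ?deg_le_max //;
  [apply: deg_gt0 uv | apply: deg_gt0 vu].
Qed.

(** Some end of an existing edge differs from [u]; the first step of a path from [u] to it is a
    neighbour of [u]. *)
Lemma connected_adj (G : sgraph) :
  connected_graph G -> (0 < #|edges G|)%N -> forall u : G, exists v, adj u v.
Proof.
move=> Gconn /card_gt0P[_ /edgesP[x [y [xy _]]]] u.
have [w uw] : exists w, u != w.
  by have [->|] := eqVneq u x; [exists y; apply: adj_neq | exists x].
have /connectP[[|v p] /= path_p wE] := Gconn u w.
  by rewrite wE eqxx in uw.
by exists v; case/andP: path_p.
Qed.

(** This replaces the unknown common degree by [max_deg G], the value in the edgewise equality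
    condition. *)
Lemma regular_max_deg (G : sgraph) :
  regular_graph G <-> forall u : G, deg u = max_deg G.
Proof.
split=> [[k degE] u|degE]; last by exists (max_deg G).
apply/eqP; rewrite eqn_leq deg_le_max /=.
by apply/bigmax_leqP => v _; rewrite !degE.
Qed.

Theorem theorem2p5 (R : realType) (G : sgraph)
    (G_connected : connected_graph G) (m_ge1 : (1 <= #|edges G|)%N) :
  2 * #|edges G|%:R <=
    geom_arith_index R G + (max_deg G)%:R * randic_index R G
  /\ (geom_arith_index R G + (max_deg G)%:R * randic_index R G
        = 2 * #|edges G|%:R
      <-> regular_graph G).
Proof.
(* Summing with [?= iff] keeps the equality case: the sums agree exactly when every edge term is
   tight. *)
have := leif_sum (fun e => @edge_term_leif R G e).
rewrite sumr_const big_split /= -mulr_sumr -[2 *+ _]mulr_natr.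
case=> le_sum eq_sum; split; first exact: le_sum.
apply: (iff_trans (B := [forall e in edges G,
                         [forall u in e, deg u == max_deg G]])).
  by rewrite -eq_sum eq_sym; split=> /eqP.
apply: iff_trans (iff_sym (regular_max_deg G)).
split=> [/forall_inP all_max u|degE]; last first.
  by apply/forall_inP=> e _; apply/forall_inP=> u _; rewrite degE.
(* Tightness only concerns ends of edges, so an edge through [u] is needed. *)
have [v uv] := connected_adj G G_connected m_ge1 u.
have /all_max/forall_inP uv_max : [set u; v] \in edges G.
  by apply/edgesP; exists u, v.
by apply/eqP/uv_max; rewrite !inE eqxx.
Qed.
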